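(* There is an absolute constant $c>0$ such that the following holds for all sufficiently large $n$. For any estimator $\tilde p(X^n)$, there is a probability distribution $p=(p_i)_{i\in\mathbb{N}}$ on $\mathbb{N}$ such that $$\mathbb{E}\|p-\tilde p\|_\infty\ge \frac{c\log n}{n\log\log n},$$ where the expectation is over a sample $X^n$ of $n$ independent observations from $p$.
   Context: $\mathbb{N}=\{1,2,\dots\}$. An estimator is any function $\tilde p$ of the sample $X^n=(X_1,\dots,X_n)\in\mathbb{N}^n$ with values in real sequences indexed by $\mathbb{N}$. $\|p-\tilde p\|_\infty=\sup_{i\in\mathbb{N}}|p_i-\tilde p_i(X^n)|$. *)

(* Defs.v *)
From mathcomp Require Export all_boot all_order all_algebra.
From mathcomp Require Export all_classical all_reals all_analysis.

Set Implicit Arguments.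
Unset Strict Implicit.
Unset Printing Implicit Defensive.

Import Order.TTheory GRing.Theory Num.Theory.
Local Open Scope classical_set_scope.
Local Open Scope ring_scope.

Notation posnat := {k : nat | (0 < k)%N}.

Section Estimation.
Variable R : realType.

Definition is_distribution (p : posnat -> R) : Prop :=
  (forall i, 0 <= p i) /\ \esum_(i in [set: posnat]) (p i)%:E = 1%E.

(* The sample space is countable and discrete, so there is no measurability
   requirement. *)
Definition estimator (n : nat) : Type := n.-tuple posnat -> posnat -> R.

(* Extended-real valued: the sequence u need not be bounded. *)
Definition sup_norm (u : posnat -> R) : \bar R :=
  ereal_sup (range (fun i => `|u i|%:E)).

(* Expectation of a nonnegative f(X_1, ..., X_n) for independent X_j with common
   law p: the joint law of the sample has mass \prod_j p(x_j) at x. The usual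
   convention 0 * +oo = 0 applies at points of mass zero. *)
Definition expectation_iid (n : nat) (p : posnat -> R)
    (f : n.-tuple posnat -> \bar R) : \bar R :=
  \esum_(x in [set: n.-tuple posnat])
    ((\prod_(j < n) p (tnth x j))%:E * f x)%E.

End Estimation.

(* Main.v *)
Require Import Defs.
From mathcomp Require Import all_boot all_order all_algebra.
From mathcomp Require Import all_classical all_reals all_analysis.
From mathcomp Require Import ring lra.
Set Implicit Arguments.
Unset Strict Implicit.
Unset Printing Implicit Defensive.
Import Order.TTheory GRing.Theory Num.Theory.
Local Open Scope classical_set_scope.
Local Open Scope ring_scope.

(** The proof hides one heavy symbol among [n] light ones.  Take a bulk symbol of
    mass about [1/2], and [n] further symbols of mass [a = 1/(2n)] each; under
    hypothesis [j], the mass of symbol [j] is raised to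
    [b = ln n / (8 n ln (ln n))], at the expense of the bulk symbol.  In the
    unperturbed law every light symbol has about a Poisson(1/2) count, and among
    [n] such counts some reach the order of [ln n / ln (ln n)]; this is also
    the count that the heavy symbol produces, so it cannot be told apart.

    In detail, moving from the unperturbed law to hypothesis [j] multiplies the
    likelihood of a sample by at most [(b/a)^N], where [N] is the number of
    occurrences of [j] ([likelihood_ratio_le]; the bulk symbol only lost mass, so
    it contributes a factor at most [1]).  By Markov's inequality
    ([markov_occurrences]) [N <= 4nb] except with probability [1/4], and then the
    factor is at most [(ln n)^(4nb) = sqrt n].  An estimator whose error is below
    [(b - a)/2] identifies [j], so the success events of the [n] hypotheses are
    disjoint, and their unperturbed probabilities add up to at most [1].  Hence the
    success probabilities add up to at most [sqrt n + n/4 < n/2], and some hypothesis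
    has failure probability at least [1/2] ([multiple_testing]).  There the
    expected error is at least [(b - a)/4 >= b/8], because [b >= 2a].

    All this takes place on a finite alphabet, which is embedded into the positive
    integers; discarding the samples outside the image can only decrease the
    expectation ([expectation_iid_pushforward_ge]). *)

(** * Independent samples from a finite alphabet *)

Section ProductLaw.
Variables (R : realType) (I T : finType).
Implicit Types (q : T -> R) (x : {ffun I -> T}).

Definition product_law q x : R := \prod_i q (x i).

Definition occurrences (t : T) x : nat := \sum_i (x i == t).

Lemma product_law_ge0 q x : (forall t, 0 <= q t) -> 0 <= product_law q x.
Proof. by move=> q0; apply: prodr_ge0. Qed.

Lemma sum_product_law q :
  \sum_t q t = 1 -> \sum_x product_law q x = 1.
Proof.
move=> q1; rewrite /product_law -(bigA_distr_bigA (fun (_ : I) t => q t)) /=.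
by apply: big1.
Qed.

Lemma mean_occurrences q t :
  \sum_s q s = 1 ->
  \sum_x product_law q x * (occurrences t x)%:R = #|I|%:R * q t.
Proof.
move=> q1.
under eq_bigr do rewrite natr_sum mulr_sumr.
rewrite exchange_big /= -sum1_card natr_sum mulr_suml.
apply: eq_bigr => i _; rewrite mul1r.
(* Inserting the indicator of [x i = t] into the product law keeps it a product,
   so its total mass factorizes over the coordinates. *)
pose F k s := q s * (if k == i then (s == t)%:R else 1).
have <- : \prod_k \sum_s F k s = q t.
  rewrite (bigD1 i) //= [X in _ * X]big1 => [|k /negPf ki]; last first.
    by rewrite /F ki -[RHS]q1; apply: eq_bigr => s _; rewrite mulr1.
  rewrite mulr1 (bigD1 t) //= big1 => [|s /negPf st].
    by rewrite /F !eqxx mulr1 addr0.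
  by rewrite /F eqxx st mulr0.
rewrite bigA_distr_bigA; apply: eq_bigr => x _.
rewrite big_split /=; congr (_ * _).
rewrite (bigD1 i) //= eqxx big1 ?mulr1// => k /negPf -> //.
Qed.

Lemma markov_occurrences q t m :
  (forall s, 0 <= q s) -> \sum_s q s = 1 -> 0 < m ->
  \sum_(x | m < (occurrences t x)%:R) product_law q x <= #|I|%:R * q t / m.
Proof.
move=> q0 q1 m0; rewrite ler_pdivlMr// -mean_occurrences// mulr_suml.
rewrite [leRHS](bigID (fun x => m < (occurrences t x)%:R)) /=.
rewrite -[leLHS]addr0 lerD//; last first.
  by apply: sumr_ge0 => x _; rewrite mulr_ge0 ?product_law_ge0.
by apply: ler_sum => x mx; rewrite ler_wpM2l ?product_law_ge0// ltW.
Qed.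

(** Only the occurrences of [t] can raise the likelihood, each by a factor at
    most [r]: every other symbol is at most as likely under [q] as under [q0]. *)
Lemma likelihood_ratio_le q q0 t r x :
  (forall s, 0 <= q s) -> q t <= r * q0 t ->
  (forall s, s != t -> q s <= q0 s) ->
  product_law q x <= r ^+ occurrences t x * product_law q0 x.
Proof.
move=> q_ge0 qt qs.
rewrite /occurrences -prodrXr -big_split /=.
apply: ler_prod => i _; rewrite q_ge0 /=.
by have [->|/qs] := eqVneq; rewrite ?expr1 // expr0 mul1r.
Qed.

End ProductLaw.

(** * Testing many hypotheses *)

(** If every [A j] had [P j]-mass above [1/2], its part inside [B j] would have
    [P j]-mass above [1/4].  As [P j] is at most [L * P0] there, [A j] would have
    [P0]-mass above [1/(4L)], hence above [1/#|J|]; this is impossible for pairwise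
    disjoint events. *)
Lemma multiple_testing (R : realType) (S J : finType)
    (P0 : S -> R) (P : J -> S -> R) (A B : J -> pred S) (L : R) :
  (0 < #|J|)%N ->
  (forall s, 0 <= P0 s) -> \sum_s P0 s = 1 ->
  (forall j s, 0 <= P j s) -> (forall j, \sum_s P j s = 1) ->
  (forall j k s, A j s -> A k s -> j = k) ->
  (forall j s, B j s -> P j s <= L * P0 s) -> 0 <= L -> L < #|J|%:R / 4 ->
  (forall j, \sum_(s | ~~ B j s) P j s <= 1 / 4) ->
  exists j, 1 / 2 <= \sum_(s | ~~ A j s) P j s.
Proof.
move=> J0 P0_ge0 P0_1 P_ge0 P_1 disjA likB L_ge0 LJ tailB.
apply/existsP; apply: contraT; rewrite negb_exists => /forallP Hj.
have J0R : 0 < #|J|%:R :> R by rewrite ltr0n.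
have hit j : 1 / 4 <= L * \sum_(s | A j s) P0 s.
  have := Hj j; rewrite -ltNge => Aj.
  have := P_1 j; rewrite (bigID (A j)) /= => Ej.
  have : \sum_(s | A j s) P j s
      <= L * (\sum_(s | A j s) P0 s) + \sum_(s | ~~ B j s) P j s.
    rewrite (bigID (B j)) /=; apply: lerD.
      rewrite mulr_sumr [leRHS](bigID (B j)) /= -[leLHS]addr0; apply: lerD.
        by apply: ler_sum => s /andP[_]; exact: likB.
      by apply: sumr_ge0 => s _; rewrite mulr_ge0.
    rewrite [leRHS](bigID (A j)) /= -[leLHS]addr0; apply: lerD.
      by under eq_bigl do rewrite andbC.
    exact: sumr_ge0.
  have := tailB j; lra.
have disj1 : \sum_j \sum_(s | A j s) P0 s <= 1.
  rewrite (exchange_big_dep predT) //= -P0_1; apply: ler_sum => s _.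
  case: (pickP (A^~ s)) => [j Ajs|A0]; last by rewrite big_pred0.
  rewrite (bigD1 j) //= big_pred0 ?addr0// => k.
  by apply/negP => /andP[Aks /eqP]; apply; exact: disjA Aks Ajs.
have : \sum_(j : J) (1 / 4 : R) <= L.
  apply: (le_trans (ler_sum _ (fun j _ => hit j))).
  by rewrite -mulr_sumr ler_piMr.
by rewrite sumr_const -mulr_natl; lra.
Qed.

(** * From a finite alphabet to the positive integers *)

Lemma esum_fintype (R : realType) (T : finType) (a : T -> \bar R) :
  (forall t, 0 <= a t)%E -> (\esum_(t in [set: T]) a t = \sum_t a t)%E.
Proof.
move=> a0; rewrite esum_fset//.
  rewrite [RHS]bigfs ?index_enum_uniq// => [|t _]; last by rewrite mem_index_enum.
  by congr (\sum_(t \in _) a t)%E; apply/seteqP; split.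
exact: finite_finset.
Qed.

Lemma sum_le_esum_inj (R : realType) (T : finType) (U : choiceType)
    (e : T -> U) (a : U -> \bar R) :
  injective e -> (forall u, 0 <= a u)%E ->
  (\sum_t a (e t) <= \esum_(u in [set: U]) a u)%E.
Proof.
move=> inj_e a0; rewrite -esum_fintype// -(@esum_image _ _ _ setT e a); last first.
  by move=> s t _ _; exact: inj_e.
rewrite esum_mkcond; apply: le_esum => u _; case: ifP => // _.
Qed.

Section Pushforward.
Variables (R : realType) (T : finType) (U : choiceType) (e : T -> U).

Definition pushforward (q : T -> R) (u : U) : R := \sum_(t | e t == u) q t.

Lemma pushforward_inj q t : injective e -> pushforward q (e t) = q t.
Proof.
by move=> inj_e; rewrite /pushforward (big_pred1 t)// => s; rewrite (inj_eq inj_e).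
Qed.

Lemma esum_pushforward q : (forall t, 0 <= q t) ->
  (\esum_(u in [set: U]) (pushforward q u)%:E = (\sum_t q t)%:E)%E.
Proof.
move=> q0; under eq_esum => u _.
  rewrite /pushforward big_mkcond -sumEFin. over.
rewrite esum_sum => [|u t _ _]; last by case: ifP; rewrite lee_fin.
rewrite -sumEFin; apply: eq_bigr => t _.
rewrite -(@esum_set1 _ _ (e t) (fun=> (q t)%:E)) ?lee_fin//.
rewrite [RHS]esum_mkcond; apply: eq_esum => u _.
by rewrite in_set1 eq_sym; case: ifP.
Qed.

End Pushforward.

Definition posnat_code (T : countType) (t : T) : posnat :=
  exist _ (pickle t).+1 (ltn0Sn _).

Lemma posnat_code_inj (T : countType) : injective (@posnat_code T).
Proof. by move=> s t /(congr1 val) /= [] /(pcan_inj pickleK). Qed.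

Lemma is_distribution_pushforward (R : realType) (T : finType) (e : T -> posnat)
    (q : T -> R) :
  (forall t, 0 <= q t) -> \sum_t q t = 1 -> is_distribution (pushforward e q).
Proof.
move=> q0 q1; split=> [u|]; first by apply: sumr_ge0.
by rewrite esum_pushforward // q1.
Qed.

Lemma sup_norm_ge (R : realType) (u : posnat -> R) i :
  (`|u i|%:E <= sup_norm u)%E.
Proof. by apply: ereal_sup_ubound; exists i. Qed.

Lemma sup_norm_ge0 (R : realType) (u : posnat -> R) : (0 <= sup_norm u)%E.
Proof.
by apply: le_trans (sup_norm_ge u (exist _ 1%N isT)); rewrite lee_fin.
Qed.

Definition encode_sample (T : Type) (e : T -> posnat) n (x : {ffun 'I_n -> T}) :
  n.-tuple posnat := [tuple e (x i) | i < n].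

(** Markov's inequality for a law carried by a finite alphabet: as all terms of
    the expectation are nonnegative, the samples outside the image of [e] and
    those in [A] may be dropped. *)
Lemma expectation_iid_pushforward_ge (R : realType) (T : finType) n
    (e : T -> posnat) (q : T -> R) (f : n.-tuple posnat -> \bar R) (d : R)
    (A : pred {ffun 'I_n -> T}) :
  injective e -> (forall t, 0 <= q t) -> (forall x, 0 <= f x)%E ->
  (forall x, ~~ A x -> d%:E <= f (encode_sample e x))%E -> 0 <= d ->
  ((d * \sum_(x | ~~ A x) \prod_i q (x i))%:E
    <= expectation_iid (pushforward e q) f)%E.
Proof.
move=> inj_e q0 f0 fA d0.
have inj_s : injective (@encode_sample T e n).
  move=> x y /(congr1 (fun s => tnth s)) exy; apply/ffunP => i.
  by apply: inj_e; move: (congr1 (fun g => g i) exy); rewrite !tnth_mktuple.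
apply: (le_trans _ (sum_le_esum_inj inj_s _)); last first.
  move=> x; apply: mule_ge0 => //; rewrite lee_fin; apply: prodr_ge0 => i _.
  exact: sumr_ge0.
rewrite mulr_sumr -sumEFin big_mkcond /=; apply: lee_sum => x _.
have -> : \prod_(j < n) pushforward e q (tnth (encode_sample e x) j)
    = \prod_i q (x i).
  by apply: eq_bigr => i _; rewrite tnth_mktuple pushforward_inj.
have qx : 0 <= \prod_i q (x i) by apply: prodr_ge0.
case: ifP => [/fA dx|_]; last by rewrite mule_ge0 ?lee_fin.
by rewrite mulrC EFinM lee_wpmul2l ?lee_fin.
Qed.

(** * A heavy symbol among many light ones *)

Lemma sum_option (V : nmodType) (J : finType) (F : option J -> V) :
  \sum_t F t = F None + \sum_j F (Some j).
Proof.
rewrite (bigD1 None) //=; congr (_ + _).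
by rewrite (reindex_omap Some id) => [|[]//]; apply: eq_bigl => j; rewrite eqxx.
Qed.

Section Spikes.
Variables (R : realType) (n : nat).
Hypothesis n_gt0 : (0 < n)%N.

Let a : R := (2 * n%:R)^-1.

(** [None] is the bulk symbol.  It absorbs the change of mass in [spiked], so that
    [j] is the only symbol whose probability goes up. *)
Definition flat (t : option 'I_n) : R := if t is Some _ then a else 1 / 2.

Definition spiked (b : R) (j : 'I_n) (t : option 'I_n) : R :=
  if t is Some i then (if i == j then b else a) else 1 / 2 - (b - a).

Let nR_gt0 : 0 < n%:R :> R. Proof. by rewrite ltr0n. Qed.

Let a_gt0 : 0 < a. Proof. by rewrite invr_gt0 mulr_gt0. Qed.

Let na : n%:R * a = 1 / 2.
Proof. by rewrite /a invfM mulrCA mulfV ?gt_eqF// mulr1 mul1r. Qed.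

Let flat_ge0 t : 0 <= flat t.
Proof. by case: t => [i|] /=; rewrite ?ltW// divr_ge0. Qed.

Let sum_flat : \sum_t flat t = 1.
Proof. by rewrite sum_option /= sumr_const card_ord -[a *+ n]mulr_natl na; lra. Qed.

Variable b : R.
Hypotheses (b_ge : n%:R^-1 <= b) (b_le : b <= 1 / 2).

Let a2b : 2 * a <= b.
Proof. by apply: le_trans b_ge; rewrite /a invfM mulrA divff ?mul1r. Qed.

Let spiked_ge0 j t : 0 <= spiked b j t.
Proof.
move: a_gt0 a2b b_le => *; case: t => [i|] /=; last lra.
by case: ifP => _; lra.
Qed.

Let sum_spiked j : \sum_t spiked b j t = 1.
Proof.
rewrite -sum_flat !sum_option /= (bigD1 j) //= [in RHS](bigD1 j) //= eqxx.
by rewrite (eq_bigr (fun=> a)) => [|i /negPf ->//]; lra.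
Qed.

Let spiked_le_flat j t : t != Some j -> spiked b j t <= flat t.
Proof.
case: t => [i|_] /=; last by move: a_gt0 a2b => *; lra.
by case: (eqVneq i j) => [->|//]; rewrite eqxx.
Qed.

(** [2nb] is the ratio of the heavy mass to a light one, and [n b] the expected
    number of occurrences of the heavy symbol.  The factor [4] in the exponent makes
    the Markov tail at most [1/4]; the last hypothesis says that the
    corresponding likelihood ratio is too small to single out one of [n]
    hypotheses. *)
Lemma spiked_minimax (l : R) (pt : estimator R n) :
  2 * n%:R * b <= l -> 1 <= l -> l `^ (4 * (n%:R * b)) < n%:R / 4 ->
  exists2 p : posnat -> R, is_distribution p &
    ((b / 8)%:E
      <= expectation_iid p (fun x => sup_norm (fun i => p i - pt x i)%R))%E.
Proof.
move=> bl l_ge1 Ln.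
move: a_gt0 a2b => a0 ab.
have b0 : 0 < b by lra.
pose e := @posnat_code (option 'I_n).
have inj_e : injective e := @posnat_code_inj _.
pose p j := pushforward e (spiked b j).
pose d := (b - a) / 2.
pose err j x := sup_norm (fun i => p j i - pt x i).
pose A j := [pred x : {ffun 'I_n -> option 'I_n} |
  (err j (encode_sample e x) < d%:E)%E].
pose m := 4 * (n%:R * b).
have m_gt0 : 0 < m by rewrite !mulr_gt0.
pose B j := [pred x : {ffun 'I_n -> option 'I_n} |
  (occurrences (Some j) x)%:R <= m].
(* An output within [d] of two hypotheses would be within [d] of both [a] and
   [b] at one and the same symbol, whereas [b - a = 2 d]. *)
have disjA j k x : A j x -> A k x -> j = k.
  move=> /= Aj Ak; apply: contraTeq (lexx (b - a)) => jk; rewrite -ltNge.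
  have := le_lt_trans (sup_norm_ge _ (e (Some j))) Aj.
  have := le_lt_trans (sup_norm_ge _ (e (Some j))) Ak.
  rewrite /p !pushforward_inj//= eqxx (negPf jk) !lte_fin !ltr_norml.
  by rewrite /d => /andP[? ?] /andP[? ?]; lra.
have likB j x : B j x ->
    product_law (spiked b j) x <= l `^ m * product_law flat x.
  move=> Bx.
  apply: (le_trans (@likelihood_ratio_le _ _ _ _ flat (Some j) l _ _ _ _)).
  - exact: spiked_ge0.
  - by rewrite /= eqxx -ler_pdivrMr// /a invrK mulrC.
  - exact: spiked_le_flat.
  rewrite ler_wpM2r ?product_law_ge0// -powR_mulrn ?(le_trans ler01)//.
  exact: ler_powR.
have tailB j : \sum_(x | ~~ B j x) product_law (spiked b j) x <= 1 / 4.
  under eq_bigl do rewrite /= -ltNge.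
  apply: (le_trans (@markov_occurrences _ _ _ _ (Some j) m _ _ _)) => //.
  rewrite card_ord /= eqxx /m ler_pdivrMr ?mulr_gt0//; lra.
have [j Hj] : exists j, 1 / 2 <= \sum_(x | ~~ A j x) product_law (spiked b j) x.
  apply: (multiple_testing (P0 := product_law flat) (B := B) (L := l `^ m)) => //.
  - by rewrite card_ord.
  - by move=> x; exact: product_law_ge0.
  - exact: sum_product_law.
  - by move=> j x; exact: product_law_ge0.
  - by move=> j; exact: sum_product_law.
  - exact: powR_ge0.
  - by rewrite card_ord.
exists (p j); first exact: is_distribution_pushforward.
apply: le_trans (expectation_iid_pushforward_ge (d := d) (A := A j) _ _ _ _ _) => //.
- rewrite lee_fin.
  have : d * (1 / 2) <= d * \sum_(x | ~~ A j x) product_law (spiked b j) x.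
    by rewrite ler_wpM2l// /d; lra.
  by apply: le_trans; rewrite /d; lra.
- by move=> x; exact: sup_norm_ge0.
- by move=> x; rewrite /= -leNgt.
- by rewrite /d; lra.
Qed.

End Spikes.

(** * The choice of the parameters *)

Theorem proposition5 (R : realType) :
  exists2 c : R, 0 < c &
    exists n0 : nat, forall n : nat, (n0 <= n)%N ->
      forall pt : estimator R n,
        exists2 p : posnat -> R, is_distribution p &
          ((c * ln n%:R / (n%:R * ln (ln n%:R)))%R%:E
             <= expectation_iid p (fun x => sup_norm (fun i => p i - pt x i)%R))%E.
Proof.
exists (1 / 64); first by [].
(* The threshold makes [y = ln (ln n)] exceed [32], so that
   [e^y >= (1 + y/2)^2 >= 8 y], which gives [1 <= n b]. *)
exists (Num.bound (expR (expR (32 : R)))) => n n_ge pt.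
set N := n%:R : R; set l := ln N; set y := ln l.
have N_gt : expR (expR 32) < N.
  by apply: lt_le_trans (archi_boundP (expR_ge0 _)) _; rewrite ler_nat.
have N_gt0 : 0 < N by apply: lt_trans N_gt; exact: expR_gt0.
have l_gt : expR 32 < l by rewrite -ltr_expR lnK.
have l_gt0 : 0 < l by apply: lt_trans l_gt; exact: expR_gt0.
have y_gt : 32 < y by rewrite -ltr_expR lnK.
have yl : 8 * y <= l.
  rewrite -[l]lnK// -/y [expR y](_ : _ = expR (y / 2) ^+ 2); last first.
    by rewrite -expRM_natl; congr expR; lra.
  have := expR_ge1Dx (y / 2); nra.
have lN : l < N by exact: ln_sublinear.
pose b := l / (8 * y) / N.
have Nb : N * b = l / (8 * y) by rewrite /b mulrC divfK ?gt_eqF.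
have ly1 : 1 <= l / (8 * y) by rewrite ler_pdivlMr; lra.
have ly2 : l / (8 * y) <= l / 2 by rewrite ler_pM2l// lef_pV2 ?posrE; lra.
have n_gt0 : (0 < n)%N by rewrite -(ltr0n R).
have b_ge : N^-1 <= b by rewrite -[leLHS]mul1r /b ler_pM2r ?invr_gt0.
have b_le : b <= 1 / 2 by rewrite /b ler_pdivrMr//; lra.
have [|||p dist_p Hp] := spiked_minimax n_gt0 b_ge b_le (l := l) pt.
- by rewrite -/N -mulrA Nb; lra.
- lra.
(* Since [(ln n)^(4nb) = n^(1/2)], and [sqrt n = expR (l / 2)] exceeds [4],
   the power is less than [n / 4]. *)
- rewrite -/N Nb /powR gt_eqF// -/y.
  have -> : 4 * (l / (8 * y)) * y = l / 2 by field; lra.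
  have E : N = expR (l / 2) ^+ 2.
    by rewrite -expRM_natl [2 * _]mulrC divfK// lnK.
  by have := expR_ge1Dx (l / 2); rewrite {}E; set s := expR _; nra.
exists p => //; apply: le_trans Hp; rewrite lee_fin.
suff -> : b / 8 = 1 / 64 * l / (N * y) by [].
by rewrite /b; field; lra.
Qed.
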